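(* Let $X$ be a countable (infinite) set (the vertex set of a graph) and let $\{x_i\}_{i \in \mathbb{N}}$ be an enumeration of $X$. Let $P$ be a transition operator on $X$ whose kernel $p$ has non-negative entries $p(x,y) \ge 0$ ($x, y \in X$) and satisfies $\sup_{x \in X} \sum_{y \in X} p(x,y) < +\infty$. Then $P$ is a bounded linear operator from $l^\infty(X)$ into itself; moreover $P$ is compact if and only if $$\lim_{n \to +\infty} \ \sup_{x \in X} \ \sum_{i > n} p(x, x_i) = 0.$$ The last condition is independent of the chosen enumeration of $X$.
   Context: The transition operator $P$ with kernel $p$ is defined by $(Pf)(x) := \sum_{y \in X} p(x,y) f(y)$ for $x \in X$ and every $f$ on $X$ such that $\sum_{y \in X} |p(x,y)|\,|f(y)| < +\infty$ for all $x \in X$. Functions take values in $\Phi = \mathbb{R}$ or $\mathbb{C}$. $l^\infty(X)$ is the Banach space of bounded functions on $X$ with the supremum norm. Compactness of $P$ means compactness as a linear operator from $l^\infty(X)$ into itself. The kernel need not be stochastic, and the graph structure on $X$ plays no role other than $X$ being its set of vertices. *)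

(* Defs.v *)
From HB Require Import structures.
From mathcomp Require Import all_boot all_order all_algebra.
From mathcomp Require Import complex.
From mathcomp Require Import all_classical all_reals all_analysis.
From mathcomp Require analysis.showcase.summability.

Set Implicit Arguments.
Unset Strict Implicit.
Unset Printing Implicit Defensive.

Import Order.TTheory GRing.Theory Num.Theory.
Import numFieldNormedType.Exports.
Import ComplexField.Normc.

Local Open Scope classical_set_scope.
Local Open Scope ring_scope.

Variant scalars := RealScalars | ComplexScalars.

Definition scalar_field (R : realType) (s : scalars) : numFieldType :=
  match s with RealScalars => R | ComplexScalars => R[i] end.

Definition of_real (R : realType) (s : scalars) : R -> scalar_field R s :=
  match s with
  | RealScalars => fun r => r
  | ComplexScalars => fun r => Complex r 0
  end.
Arguments of_real {R} s r.

(* On R[i] the norm of the numFieldType structure takes its values in R[i];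
   absR is the R-valued modulus, see absRE. *)
Definition absR (R : realType) (s : scalars) : scalar_field R s -> R :=
  match s with
  | RealScalars => fun z => `|z|
  | ComplexScalars => fun z => normc z
  end.
Arguments absR {R s} z.

Section scalars_theory.
Variables (R : realType) (s : scalars).
Implicit Types (z w : scalar_field R s) (r : R).

Lemma absRE z : `|z| = of_real s (absR z).
Proof. by case: s z => //= -[a b]. Qed.

Lemma of_realD r1 r2 : of_real s (r1 + r2) = of_real s r1 + of_real s r2.
Proof. by case: s => //=; exact: (rmorphD (real_complex R)). Qed.

Lemma of_realM r1 r2 : of_real s (r1 * r2) = of_real s r1 * of_real s r2.
Proof. by case: s => //=; exact: (rmorphM (real_complex R)). Qed.

Lemma of_real0 : of_real s 0 = 0 :> scalar_field R s.
Proof. by case: s. Qed.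

Lemma ler_of_real r1 r2 : (of_real s r1 <= of_real s r2) = (r1 <= r2).
Proof. by case: s => //=; exact: lecR. Qed.

Lemma of_real_inj : injective (of_real s : R -> scalar_field R s).
Proof. by case: s => // r1 r2 []. Qed.

Lemma absR_ge0 z : 0 <= absR z.
Proof. by rewrite -ler_of_real of_real0 -absRE. Qed.

Lemma absR_of_real r : absR (of_real s r) = `|r|.
Proof. by case: s => //=; rewrite expr0n addr0 sqrtr_sqr. Qed.

Lemma absRD z w : absR (z + w) <= absR z + absR w.
Proof. by rewrite -ler_of_real of_realD -!absRE ler_normD. Qed.

Lemma absRM z w : absR (z * w) = absR z * absR w.
Proof. by apply: of_real_inj; rewrite of_realM -!absRE normrM. Qed.

Lemma absR_eq0 z : absR z = 0 -> z = 0.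
Proof. by move=> z0; apply/eqP; rewrite -normr_eq0 absRE z0 of_real0. Qed.

End scalars_theory.

Section linf.
Variables (R : realType) (s : scalars) (X : choiceType).
Local Notation K := (scalar_field R s).

Definition linf_pred : {pred X -> K^o} := mem [set f : X -> K^o | bounded_fun f].

Lemma linf_predP (f : X -> K^o) :
  f \in linf_pred <-> has_ubound (range (fun x => absR (f x))).
Proof.
split=> [|[M Mf]].
  rewrite inE /= => /pinfty_ex_gt0[M M0 Mf]; exists (absR M) => _ [x _ <-].
  rewrite -(ler_of_real s) -!absRE (ger0_norm (ltW M0)); exact: Mf.
rewrite inE /=; exists `|of_real s M|; split; first exact: normr_real.
move=> N MN x _ /=; apply: le_trans (ltW MN); rewrite absRE.
rewrite absRE absR_of_real ler_of_real (le_trans _ (ler_norm M))//.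
by apply: Mf; exists x.
Qed.

Lemma linf_pred_submod : submod_closed linf_pred.
Proof.
split.
  by rewrite inE /=; exact: bounded_cst.
move=> a f g /linf_predP[M Mf] /linf_predP[N Ng]; apply/linf_predP.
exists (absR a * M + N) => _ [x _ <-]; apply: le_trans (absRD _ _) _.
apply: lerD; last by apply: Ng; exists x.
by rewrite absRM ler_wpM2l ?absR_ge0//; apply: Mf; exists x.
Qed.

HB.instance Definition _ :=
  GRing.isSubmodClosed.Build K (X -> K^o) linf_pred linf_pred_submod.

Record linf := Linf {
  linf_fun :> X -> K^o;
  _ : linf_fun \in linf_pred }.

HB.instance Definition _ := [isSub for linf_fun].
HB.instance Definition _ := [Choice of linf by <:].
HB.instance Definition _ := [SubChoice_isSubLmodule of linf by <:].

Implicit Types f g : linf.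

Definition linf_norm f : K := of_real s (sup (range (fun x => absR (f x)))).

Lemma linf_has_ubound f : has_ubound (range (fun x => absR (f x))).
Proof. by apply/linf_predP; exact: valP. Qed.

Lemma absR_le_linf f x : absR (f x) <= sup (range (fun y => absR (f y))).
Proof. by apply: ub_le_sup; [exact: linf_has_ubound|exists x]. Qed.

Lemma sup_range_le (u : X -> R) (M : R) :
  0 <= M -> (forall x, u x <= M) -> sup (range u) <= M.
Proof.
move=> M0 uM; have [->|/set0P ne] := eqVneq (range u) set0; first by rewrite sup0.
by apply: ge_sup => // _ [x _ <-].
Qed.

Lemma linf_sup_ge0 f : 0 <= sup (range (fun x => absR (f x))).
Proof.
have [->|/set0P[_ [x _ _]]] := eqVneq (range (fun x => absR (f x))) set0.
  by rewrite sup0.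
exact: le_trans (absR_ge0 _) (absR_le_linf f x).
Qed.

Lemma linf_normD f g : linf_norm (f + g) <= linf_norm f + linf_norm g.
Proof.
rewrite /linf_norm -of_realD ler_of_real; apply: sup_range_le.
  by rewrite addr_ge0 ?linf_sup_ge0.
move=> x; apply: le_trans (absRD (f x) (g x)) _.
by rewrite lerD ?absR_le_linf.
Qed.

Lemma linf_normZ (a : K) f : linf_norm (a *: f) = `|a| * linf_norm f.
Proof.
rewrite /linf_norm absRE -of_realM; congr of_real.
have le_supZ (b : K) g : sup (range (fun x => absR ((b *: g) x)))
    <= absR b * sup (range (fun x => absR (g x))).
  apply: sup_range_le; first by rewrite mulr_ge0 ?absR_ge0 ?linf_sup_ge0.
  move=> x; have -> : absR ((b *: g) x) = absR b * absR (g x) by rewrite -absRM.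
  by rewrite ler_wpM2l ?absR_ge0 ?absR_le_linf.
apply/eqP; rewrite eq_le le_supZ /=.
have [a0|a0] := eqVneq a 0.
  have -> : absR a = 0.
    by apply: (@of_real_inj R s); rewrite -absRE a0 normr0 of_real0.
  by rewrite mul0r; exact: (linf_sup_ge0 (a *: f)).
have absa0 : 0 < absR a.
  by rewrite lt_def absR_ge0 andbT; apply/eqP => /absR_eq0/eqP; apply/negP.
have := le_supZ a^-1 (a *: f); rewrite scalerA mulVf// scale1r.
rewrite -(ler_pM2l absa0) mulrA -absRM mulfV//.
have -> : absR (1 : K) = 1.
  apply: (@of_real_inj R s); rewrite -absRE normr1.
  by case: (s).
by rewrite mul1r.
Qed.

Lemma linf_norm_eq0 f : linf_norm f = 0 -> f = 0.
Proof.
rewrite /linf_norm -[0 in RHS](of_real0 R s) => /(@of_real_inj R s) f0.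
apply: val_inj; apply/funext => x; apply: absR_eq0; apply/eqP.
by rewrite eq_le absR_ge0 andbT -f0 absR_le_linf.
Qed.

HB.instance Definition _ :=
  Lmodule_isNormed.Build K linf linf_normD linf_normZ linf_norm_eq0.

End linf.
Arguments linf R s X : clear implicits.

Section operators.
Variables (K : numFieldType) (V W : normedModType K).

Definition bounded_operator (T : V -> W) : Prop :=
  exists M : K, forall v, `|T v| <= M * `|v|.

Definition compact_operator (T : V -> W) : Prop :=
  forall A : set V, bounded_set A -> precompact (T @` A).

End operators.

Section transition_operator.
Variables (R : realType) (s : scalars) (X : choiceType) (p : X -> X -> R).

Definition transition_dom (f : X -> scalar_field R s) : Prop :=
  forall x, (\esum_(y in [set: X]) (`|p x y| * absR (f y))%:E < +oo)%E.

(* [summability.sum] is the limit of the net of sums over finite subsets. *)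
Definition transition_op (f : X -> scalar_field R s) : X -> scalar_field R s :=
  fun x => summability.sum (fun y => of_real s (p x y) * f y : (scalar_field R s)^o).

(* The sums are unsigned: meaningful for p >= 0 only. *)
Definition uniform_tails (e : nat -> X) : Prop :=
  (fun n => ereal_sup
     [set (\esum_(i in [set i | (n < i)%N]) (p x (e i))%:E)%E | x in [set: X]])
    @ \oo --> 0%E.

End transition_operator.

(* Main.v *)
Require Import Defs.
From HB Require Import structures.
From mathcomp Require Import all_boot all_order all_algebra finmap.
From mathcomp Require Import complex.
From mathcomp Require Import all_classical all_reals all_analysis.
From mathcomp Require analysis.showcase.summability.

Import Order.TTheory GRing.Theory Num.Theory.
Import numFieldNormedType.Exports.
Import ComplexField.Normc.

Local Open Scope classical_set_scope.
Local Open Scope ring_scope.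

(** Both sides of the equivalence are compared with a condition that mentions
no enumeration, [uniformly_tight p]: for every [eps] there is a finite set [A]
such that every row of [p] has mass at most [eps] off [A]. For any enumeration
this is the vanishing of the tails (every finite set lies in an initial segment,
and every initial segment is finite), which also settles the independence of
the enumeration: see [uniform_tailsP].

Row sums are bounded by some [C], so [P f] is an absolutely convergent sum of
modulus at most [C * r] when [|f| <= r]; this gives the bounded linear operator
([transition_linear_exists]).

If [p] is tight, then on each ball of l^oo pointwise convergence [g --> f]
forces [P g --> P f] in norm ([tight_cvg_image]): off a finite set [A] the
contribution is small uniformly in the row, and on [A] pointwise convergence is
uniform. Balls are compact for pointwise convergence, so the image of a ball is
compact for the norm ([tight_compact_image]). The pointwise compactness is used
through ultrafilters, along which every bounded scalar function converges
([ultra_bounded_cvg]).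

Conversely, let [P] be compact and let [ind A] be the indicator of the complement
of a finite set [A]. As [A] grows, [P (ind A)] tends to 0 at every point, because
each single row is summable. By compactness the net has a cluster point in norm,
which can only be 0; so some [A] satisfies [|P (ind A)| <= eps]. As [p >= 0], the
value of [P (ind A)] at [x] is the mass of the row [x] off [A], and this is
tightness ([compact_operator_tight]). *)

(** * Limits of scalars through the real modulus *)

Section ComplexModulus.
Context {R : realType}.
Implicit Types z : R[i].

Lemma ler_Re_normc z : `|complex.Re z| <= normc z.
Proof.
by case: z => a b /=; rewrite -sqrtr_sqr ler_wsqrtr// lerDl sqr_ge0.
Qed.

Lemma ler_Im_normc z : `|complex.Im z| <= normc z.
Proof.
by case: z => a b /=; rewrite -sqrtr_sqr ler_wsqrtr// lerDr sqr_ge0.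
Qed.

Lemma normc_ler_ReIm z : normc z <= `|complex.Re z| + `|complex.Im z|.
Proof.
case: z => a b.
rewrite [X in normc X](_ : _ = Complex a 0 + Complex 0 b); last first.
  by apply/eqP; rewrite eq_complex /= addr0 add0r !eqxx.
by apply: le_trans (le_normcD _ _) _; rewrite /= !expr0n /= addr0 add0r !sqrtr_sqr.
Qed.

End ComplexModulus.

Section ScalarLimits.
Context {R : realType} {s : scalars}.
Implicit Types (z : scalar_field R s) (eps : R).

Lemma absRN z : absR (- z) = absR z.
Proof. by apply: (@of_real_inj R s); rewrite -!absRE normrN. Qed.

Lemma absR_distC z w : absR (z - w) = absR (w - z).
Proof. by rewrite -absRN opprB. Qed.

Lemma absR0 : absR (0 : scalar_field R s) = 0.
Proof. by rewrite -(of_real0 R s) absR_of_real normr0. Qed.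

Lemma absR_triangle z w v : absR (z - v) <= absR (z - w) + absR (w - v).
Proof. by rewrite -[z - v](subrKA w) absRD. Qed.

Lemma absR_sum (I : Type) (B : seq I) (u : I -> scalar_field R s) :
  absR (\sum_(i <- B) u i) <= \sum_(i <- B) absR (u i).
Proof.
elim/big_rec2: _ => [|i r z _ le_zr]; first by rewrite absR0.
by apply: le_trans (absRD _ _) _; rewrite lerD2l.
Qed.

(** Positive elements of the scalar field are real: balls with radius in [R]
determine the topology even over [R[i]]. *)
Lemma pos_of_real (e : scalar_field R s) : 0 < e ->
  exists2 r : R, 0 < r & e = of_real s r.
Proof.
move=> e0; have ge := ltW e0; exists (absR e).
  rewrite lt_neqAle absR_ge0 andbT eq_sym; apply/eqP => /absR_eq0 e00.
  by move: e0; rewrite e00 ltxx.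
by rewrite -absRE ger0_norm.
Qed.

Lemma of_real_gt0 eps : 0 < eps -> 0 < of_real s eps.
Proof.
move=> eps0; rewrite lt_neqAle -(of_real0 R s) ler_of_real ltW// andbT.
by apply/eqP => /of_real_inj eps00; move: eps0; rewrite -eps00 ltxx.
Qed.

Lemma cvg_absRP (T : Type) (F : set_system T) (FF : Filter F)
    (u : T -> (scalar_field R s)^o) (l : (scalar_field R s)^o) :
  u @ F --> l <->
  forall eps, 0 < eps -> \forall t \near F, absR (l - u t) <= eps.
Proof.
split=> [/cvgrPdist_le ul eps /of_real_gt0 eps0|ul].
  by apply: filterS (ul _ eps0) => t; rewrite absRE ler_of_real.
apply/cvgrPdist_le => _ /pos_of_real[eps eps0 ->].
by apply: filterS (ul _ eps0) => t; rewrite absRE ler_of_real.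
Qed.

(** The limit is the supremum of the eventual lower bounds of [u]: a number above
it is not an eventual lower bound, and for an ultrafilter this means that [u] is
eventually smaller than that number. *)
Lemma ultra_bounded_cvg_real (T : Type) (F : set_system T) (FU : UltraFilter F)
    (u : T -> R) (M : R) : (\forall t \near F, `|u t| <= M) ->
  exists l : R, forall eps, 0 < eps -> \forall t \near F, `|l - u t| <= eps.
Proof.
move=> uM; have FF : ProperFilter F by exact: ultra_proper.
pose S := [set r : R | \forall t \near F, r <= u t].
have supS : has_sup S.
  split; first by exists (- M); apply: filterS uM => t; rewrite ler_norml => /andP[].
  exists M => r Sr; have [t [rt tM]] := filter_ex (filterI Sr uM).
  by apply: le_trans rt _; apply: le_trans (ler_norm _) tM.
exists (sup S) => eps eps0.
have [r Sr rS] := sup_adherent eps0 supS.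
have [up|] := in_ultra_setVsetC [set t | sup S + eps <= u t] FU.
  have : sup S + eps <= sup S by apply: ub_le_sup => //; case: supS.
  by rewrite gerDl leNgt eps0.
move=> dn; apply: filterS (filterI Sr dn) => t [/= rt /negP]; rewrite -ltNge => tS.
rewrite distrC ler_distl; apply/andP; split; last exact: ltW.
exact: le_trans (ltW rS) rt.
Qed.

(** Bolzano-Weierstrass in ultrafilter form; the complex case goes through the
real and imaginary parts. *)
Lemma ultra_bounded_cvg (T : Type) (F : set_system T) (FU : UltraFilter F)
    (u : T -> (scalar_field R s)^o) (M : R) :
  (\forall t \near F, absR (u t) <= M) -> exists l : (scalar_field R s)^o, u @ F --> l.
Proof.
move=> uM; have FF : ProperFilter F by exact: ultra_proper.
suff [l ul] : exists l : scalar_field R s,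
    forall eps, 0 < eps -> \forall t \near F, absR (l - u t) <= eps.
  by exists l; apply/cvg_absRP.
case: s u uM => /= u uM; first exact: ultra_bounded_cvg_real uM.
have [a ua] : exists l : R, forall eps, 0 < eps ->
    \forall t \near F, `|l - complex.Re (u t)| <= eps.
  apply: (@ultra_bounded_cvg_real _ _ _ _ M); apply: filterS uM => t.
  by apply: le_trans; exact: ler_Re_normc.
have [b ub] : exists l : R, forall eps, 0 < eps ->
    \forall t \near F, `|l - complex.Im (u t)| <= eps.
  apply: (@ultra_bounded_cvg_real _ _ _ _ M); apply: filterS uM => t.
  by apply: le_trans; exact: ler_Im_normc.
exists (Complex a b) => eps eps0.
have eps20 : 0 < eps / 2 by rewrite divr_gt0.
apply: filterS (filterI (ua _ eps20) (ub _ eps20)) => t [at_ bt].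
apply: le_trans (normc_ler_ReIm _) _.
by case: (u t) at_ bt => c d /= ac bd; rewrite [eps]splitr lerD.
Qed.

Lemma absR_le_cvg (T : Type) (F : set_system T) (FF : ProperFilter F)
    (f : T -> (scalar_field R s)^o)
    (l : (scalar_field R s)^o) (r : R) :
  f @ F --> l -> (\forall t \near F, absR (f t) <= r) -> absR l <= r.
Proof.
move=> /cvg_absRP fl fr; apply/ler_addgt0Pr => d d0.
have [t [lt rt]] := filter_ex (filterI (fl _ d0) fr).
have := absRD (l - f t) (f t); rewrite subrK => /le_trans; apply.
by rewrite [leRHS]addrC lerD.
Qed.

End ScalarLimits.

(** * Unordered sums *)

Lemma sum_fsubset (V : nmodType) (X : choiceType) (u : X -> V) (A B : {fset X}) :
  (A `<=` B)%fset ->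
  \sum_(y <- B) u y = \sum_(y <- A) u y + \sum_(y <- (B `\` A)%fset) u y.
Proof.
move=> AB; rewrite (big_fsetID _ (mem A))/=; congr (_ + _); apply: eq_fbigl => y.
  by rewrite !inE/= andbC; case: (boolP (y \in A)) => // /(fsubsetP AB).
by rewrite !inE/= andbC.
Qed.

Section UnorderedSums.
Context {R : realType} {X : choiceType}.
Implicit Types (a : X -> R) (A B : {fset X}).

Lemma ler_sum_fsubset a A B : (forall y, 0 <= a y) -> (A `<=` B)%fset ->
  \sum_(y <- A) a y <= \sum_(y <- B) a y.
Proof. by move=> a0 AB; rewrite (sum_fsubset _ _ _ _ _ AB) lerDl sumr_ge0. Qed.

(** Take for [A] a finite set whose sum is within [eps] of the supremum of all
finite sums. *)
Lemma bounded_sums_tail a (M : R) : (forall y, 0 <= a y) ->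
  (forall B, \sum_(y <- B) a y <= M) ->
  forall eps, 0 < eps ->
  exists A, forall B, [disjoint B & A]%fset -> \sum_(y <- B) a y <= eps.
Proof.
move=> a0 aM eps eps0.
pose S := range (fun B : {fset X} => \sum_(y <- B) a y).
have supS : has_sup S.
  by split; [exists 0, fset0 => //; rewrite big_seq_fset0|exists M => _ [B _ <-]].
have [_ [A _ <-] Aeps] := sup_adherent eps0 supS.
exists A => B BA.
have : \sum_(y <- (A `|` B)%fset) a y <= sup S.
  by apply: ub_le_sup; [case: supS|exists (A `|` B)%fset].
rewrite (sum_fsubset _ _ _ A) ?fsubsetUl// fsetDUl fsetDv fset0U.
have -> : (B `\` A)%fset = B by exact/fsetDidPl.
move=> ABS; rewrite -(lerD2l (\sum_(y <- A) a y)).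
by apply: le_trans ABS _; rewrite -lerBlDr ltW.
Qed.

(** Bounds on finite sums replace extended-real sums throughout the proof; this
translates the hypotheses and the tails of the theorem into them. *)
Lemma esum_le_sumP a (D : set X) (r : R) : (forall y, 0 <= a y) ->
  (\esum_(y in D) (a y)%:E <= r%:E)%E <->
  (forall B, [set` B] `<=` D -> \sum_(y <- B) a y <= r).
Proof.
move=> a0; split=> [Dr B BD|Br].
  rewrite -lee_fin; apply: le_trans Dr; apply: esum_ge; exists [set` B] => //.
  by rewrite fsbig_finite//= set_fsetK sumEFin.
apply: ge_ereal_sup => _ [C [finC CD] <-].
rewrite fsbig_finite//= sumEFin lee_fin; apply: Br.
by rewrite fset_setK.
Qed.

Lemma near_totally (P : {fset X} -> Prop) A :
  (forall B, (A `<=` B)%fset -> P B) -> \forall B \near summability.totally, P B.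
Proof. by move=> AP; exists A. Qed.

Context {s : scalars}.
Local Notation K := (scalar_field R s).
Implicit Types (u v : X -> K^o).

Lemma partial_sumE u B : summability.partial_sum u B = \sum_(y <- B) u y.
Proof. by rewrite /summability.partial_sum (big_seq_fsetE _ _ xpredT). Qed.

(** Along an ultrafilter finer than the filter of growing finite sets the partial
sums converge, being bounded; as they form a Cauchy net, they converge to the
same limit along the original filter. *)
Lemma abs_summable_cvg u (M : R) : (forall B, \sum_(y <- B) absR (u y) <= M) ->
  summability.partial_sum u B @[B --> summability.totally] --> summability.sum u.
Proof.
move=> uM; have FT := @summability.totally_filter X.
have abs0 y : 0 <= absR (u y) by exact: absR_ge0.
suff [l ul] : exists l : K^o,
    summability.partial_sum u B @[B --> summability.totally] --> l.
  by apply/cvg_ex; exists l.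
have [U [UU TU]] := ultraFilterLemma FT.
have FU : ProperFilter U by exact: ultra_proper.
have [l ul] : exists l : K^o, summability.partial_sum u @ U --> l.
  apply: (@ultra_bounded_cvg _ _ _ _ _ _ M).
  by apply: nearW => B; rewrite partial_sumE; apply: le_trans (uM B); exact: absR_sum.
exists l; apply/cvg_absRP => eps eps0.
have eps20 : 0 < eps / 2 by rewrite divr_gt0.
have [A tailA] := bounded_sums_tail _ _ abs0 uM _ eps20.
have near_A C : (A `<=` C)%fset ->
    absR (summability.partial_sum u C - summability.partial_sum u A) <= eps / 2.
  move=> sAC; rewrite !partial_sumE (sum_fsubset _ _ _ _ _ sAC) addrC addKr.
  apply: le_trans; first exact: absR_sum.
  by apply: tailA; apply/fdisjointP => y; rewrite !inE => /andP[].
have lA : absR (l - summability.partial_sum u A) <= eps / 2.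
  have /cvg_absRP lU := ul; apply/ler_addgt0Pr => d d0.
  have [C [lC sAC]] := filter_ex (filterI (lU d d0) (TU _ (near_totally _ A near_A))).
  rewrite [leRHS]addrC.
  apply: le_trans (absR_triangle _ (summability.partial_sum u C) _) _.
  exact: lerD lC sAC.
apply: (@near_totally _ A) => C sAC; rewrite [eps]splitr.
apply: le_trans (absR_triangle _ (summability.partial_sum u A) _) _.
by apply: lerD lA _; rewrite absR_distC near_A.
Qed.

Lemma absR_sum_le u (M : R) : (forall B, \sum_(y <- B) absR (u y) <= M) ->
  absR (summability.sum u) <= M.
Proof.
move=> uM; have FT := @summability.totally_filter X.
apply: absR_le_cvg (abs_summable_cvg _ _ uM) _.
by apply: nearW => B; rewrite partial_sumE; apply: le_trans (absR_sum _ _ _) (uM B).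
Qed.

(** A sum of non-negative terms dominates its partial sums. The modulus on the
right avoids real parts in the complex case. *)
Lemma ler_sum_absR (a : X -> R) (M : R) B : (forall y, 0 <= a y) ->
  (forall C : {fset X}, \sum_(y <- C) a y <= M) ->
  \sum_(y <- B) a y <= absR (summability.sum (fun y => of_real s (a y) : K^o)).
Proof.
move=> a0 aM; have FT := @summability.totally_filter X.
have absa y : absR (of_real s (a y)) = a y by rewrite absR_of_real ger0_norm.
have aM' (C : {fset X}) : \sum_(y <- C) absR (of_real s (a y)) <= M.
  by under eq_bigr do rewrite absa.
have /cvg_absRP al := abs_summable_cvg (fun y => of_real s (a y)) _ aM'.
apply/ler_addgt0Pr => d d0.
have [C [lC BC]] := filter_ex (filterI (al _ d0) (near_totally _ B (fun C H => H))).
apply: le_trans (ler_sum_fsubset _ _ _ a0 BC) _.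
have -> : \sum_(y <- C) a y = absR (\sum_(y <- C) of_real s (a y)).
  rewrite -(big_morph _ (of_realD s) (of_real0 R s)) absR_of_real.
  by rewrite ger0_norm// sumr_ge0.
rewrite partial_sumE absR_distC in lC.
set S := summability.sum _ in lC *.
have := absRD (\sum_(y <- C) of_real s (a y) - S) S; rewrite subrK => /le_trans.
by apply; rewrite [leRHS]addrC lerD2r.
Qed.

Lemma sum_linear (k : K) u v (M N : R) :
  (forall B, \sum_(y <- B) absR (u y) <= M) ->
  (forall B, \sum_(y <- B) absR (v y) <= N) ->
  summability.sum (fun y => k * u y + v y : K^o)
  = k * summability.sum u + summability.sum v.
Proof.
move=> uM vN; have FT := @summability.totally_filter X.
apply: (@cvg_lim K^o); first exact: norm_hausdorff.
have -> : summability.partial_sum (fun y => k * u y + v y : K^o)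
    = (k \*: summability.partial_sum u + summability.partial_sum v : _ -> K^o).
  apply/funext => B; rewrite /= !fctE !partial_sumE big_split/=.
  by rewrite -mulr_sumr -partial_sumE.
apply: (@cvgD K K^o); last exact: (abs_summable_cvg _ _ vN).
by apply: (@cvgZl_tmp K K^o); exact: (abs_summable_cvg _ _ uM).
Qed.

End UnorderedSums.

(** * Bounded functions *)

Section BoundedFunctions.
Context {R : realType} {s : scalars} {X : choiceType}.
Implicit Types (f g : linf R s X) (r : R).

Definition linf_ball r : set (linf R s X) := [set f | forall x, absR (f x) <= r].

Lemma linf_norm_leP f r : 0 <= r -> `|f| <= of_real s r <-> linf_ball r f.
Proof.
move=> r0; have -> : `|f| = linf_norm f by [].
rewrite /linf_norm ler_of_real; split=> [fr x|fr]; last exact: sup_range_le.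
exact: le_trans (absR_le_linf f x) fr.
Qed.

Lemma linf_ballB f g r1 r2 : linf_ball r1 f -> linf_ball r2 g ->
  linf_ball (r1 + r2) (f - g).
Proof.
move=> fr gr x; apply: le_trans (lerD (fr x) (gr x)).
by rewrite -(absRN (g x)); exact: absRD.
Qed.

Lemma linf_of_bounded (u : X -> scalar_field R s) r : (forall x, absR (u x) <= r) ->
  {f : linf R s X | forall x, f x = u x}.
Proof.
move=> ur; suff ub : (u : X -> (scalar_field R s)^o) \in @linf_pred R s X.
  by exists (Linf ub).
by apply/linf_predP; exists r => _ [x _ <-].
Qed.

Lemma bounded_setP (D : set (linf R s X)) :
  bounded_set D <-> exists r, D `<=` linf_ball r.
Proof.
split=> [/pinfty_ex_gt0[_ /pos_of_real[r r0 ->] Dr]|[r Dr]].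
  by exists r => f Df; apply/linf_norm_leP; [exact: ltW|exact: Dr].
exists (of_real s `|r|); split.
  by rewrite realE -(of_real0 R s) ler_of_real normr_ge0.
move=> M /ltW rM f Df; apply: le_trans rM; apply/linf_norm_leP => // x.
exact: le_trans (Dr f Df x) (ler_norm r).
Qed.

Lemma cvg_linfP (T : Type) (F : set_system T) (FF : Filter F)
    (u : T -> linf R s X) (l : linf R s X) :
  u @ F --> l <->
  forall eps, 0 < eps -> \forall t \near F, linf_ball eps (l - u t).
Proof.
split=> [/cvgrPdist_le ul eps eps0|ul].
  apply: filterS (ul _ (of_real_gt0 eps eps0)) => t lt.
  by apply/linf_norm_leP => //; exact: ltW.
apply/cvgrPdist_le => _ /pos_of_real[eps eps0 ->].
by apply: filterS (ul _ eps0) => t lt; apply/linf_norm_leP => //; exact: ltW.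
Qed.

End BoundedFunctions.

(** * The transition operator *)

Lemma row_sums_bounded {R : realType} {X : choiceType} {p : X -> X -> R} :
  (forall x y, 0 <= p x y) ->
  (ereal_sup [set \esum_(y in [set: X]) (p x y)%:E | x in [set: X]] < +oo)%E ->
  exists C : R, forall x (B : {fset X}), \sum_(y <- B) p x y <= C.
Proof.
move=> p_ge0; set S := ereal_sup _ => Soo.
exists (fine S) => x B.
have xS : (\esum_(y in [set: X]) (p x y)%:E <= S)%E by apply: ereal_sup_ubound; exists x.
apply: (iffLR (esum_le_sumP _ [set: X] _ (p_ge0 x))) => //.
rewrite fineK// ge0_fin_numE//; apply: le_trans xS.
by apply: esum_ge0 => y _; rewrite lee_fin.
Qed.

Section TransitionOperator.
Context {R : realType} {s : scalars} {X : choiceType} {p : X -> X -> R} {C : R}.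
Hypothesis p_ge0 : forall x y, 0 <= p x y.
Hypothesis p_sum : forall x (B : {fset X}), \sum_(y <- B) p x y <= C.
Local Notation K := (scalar_field R s).
Implicit Types (f : X -> K).

Lemma absR_transition_term f x y : absR (of_real s (p x y) * f y) = p x y * absR (f y).
Proof. by rewrite absRM absR_of_real ger0_norm. Qed.

(** The estimate behind both directions: a function that is at most [d] on [A] and
at most [r] everywhere is averaged to at most [C * d + t * r] by a row of mass
at most [C], of which at most [t] lies off [A]. *)
Lemma transition_sums_le f (A : {fset X}) (d r t : R) x (B : {fset X}) :
    0 <= d -> 0 <= r ->
    (forall y, y \in A -> absR (f y) <= d) -> (forall y, absR (f y) <= r) ->
    (forall B' : {fset X}, [disjoint B' & A]%fset -> \sum_(y <- B') p x y <= t) ->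
  \sum_(y <- B) absR (of_real s (p x y) * f y) <= C * d + t * r.
Proof.
move=> d0 r0 fd fr pt; rewrite (big_fsetID _ (mem A))/=; apply: lerD.
  apply: le_trans (ler_wpM2r d0 (p_sum x [fset y in B | y \in A]%fset)).
  rewrite mulr_suml big_seq [leRHS]big_seq; apply: ler_sum => y.
  by rewrite !inE/= => /andP[_ yA]; rewrite absR_transition_term ler_wpM2l// fd.
apply: le_trans (ler_wpM2r r0 (pt [fset y in B | y \notin A]%fset _)); last first.
  by apply/fdisjointP => y; rewrite !inE => /andP[].
by rewrite mulr_suml; apply: ler_sum => y _; rewrite absR_transition_term ler_wpM2l.
Qed.

Lemma transition_sums_bounded f (r : R) x (B : {fset X}) : (forall y, absR (f y) <= r) ->
  \sum_(y <- B) absR (of_real s (p x y) * f y) <= C * r.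
Proof.
move=> fr; have r0 : 0 <= r by apply: le_trans (fr x); exact: absR_ge0.
have -> : C * r = C * 0 + C * r by rewrite mulr0 add0r.
by apply: (transition_sums_le f fset0 0 r C x B) => // y; rewrite inE.
Qed.

Lemma transition_op_le f (A : {fset X}) (d r t : R) x :
    0 <= d -> 0 <= r ->
    (forall y, y \in A -> absR (f y) <= d) -> (forall y, absR (f y) <= r) ->
    (forall B' : {fset X}, [disjoint B' & A]%fset -> \sum_(y <- B') p x y <= t) ->
  absR (transition_op p f x) <= C * d + t * r.
Proof. by move=> *; apply: absR_sum_le => B; exact: (transition_sums_le _ A). Qed.

Lemma transition_op_bounded f (r : R) x : (forall y, absR (f y) <= r) ->
  absR (transition_op p f x) <= C * r.
Proof. by move=> fr; apply: absR_sum_le => B; exact: transition_sums_bounded. Qed.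

Lemma transition_dom_bounded f (r : R) : (forall y, absR (f y) <= r) ->
  transition_dom p f.
Proof.
move=> fr x; apply: (@le_lt_trans _ _ (C * r)%:E); last exact: ltry.
apply/esum_le_sumP => [y|B _]; first by rewrite mulr_ge0 ?absR_ge0.
under eq_bigr do rewrite ger0_norm// -absR_transition_term.
exact: transition_sums_bounded.
Qed.

Lemma transition_linear_exists : exists P : {linear linf R s X -> linf R s X},
  forall f : linf R s X, P f = transition_op p f :> (X -> K).
Proof.
have opP (f : linf R s X) : exists g : linf R s X, g = transition_op p f :> (X -> K).
  have /linf_predP[r fr] := valP f.
  have fr' x : absR (f x) <= r by apply: fr; exists x.
  have [g gE] := linf_of_bounded (transition_op p f) (C * r)
    (fun x => transition_op_bounded _ _ _ fr').
  by exists g; apply/funext.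
have [P PE] := choice opP.
have linP : linear P.
  move=> k f g; apply: val_inj; apply/funext => x.
  have -> : val (P (k *: f + g)) x = transition_op p (k *: f + g) x by rewrite -PE.
  have -> : val (k *: P f + P g) x = k * transition_op p f x + transition_op p g x.
    by rewrite -!PE.
  have /linf_predP[r fr] := valP f.
  have /linf_predP[q gq] := valP g.
  rewrite /transition_op -(sum_linear _ _ _ (C * r) (C * q)).
  - by congr summability.sum; apply/funext => y; rewrite mulrCA -mulrDr.
  - by move=> B; apply: transition_sums_bounded => y; apply: fr; exists y.
  - by move=> B; apply: transition_sums_bounded => y; apply: gq; exists y.
pose L := GRing.isLinear.Build _ _ _ _ P linP.
by exists (HB.pack_for {linear linf R s X -> linf R s X} P L).
Qed.

End TransitionOperator.

(** * Tightness and compactness *)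

(** Enumeration-free form of the vanishing of the tails; the name is that of
tightness for families of measures, here the rows of [p]. *)
Definition uniformly_tight {R : realType} {X : choiceType} (p : X -> X -> R) :=
  forall eps, 0 < eps -> exists A : {fset X}, forall x (B : {fset X}),
    [disjoint B & A]%fset -> \sum_(y <- B) p x y <= eps.

Section Compactness.
Context {R : realType} {s : scalars} {X : choiceType} {p : X -> X -> R} {C : R}.
Hypothesis p_ge0 : forall x y, 0 <= p x y.
Hypothesis p_sum : forall x (B : {fset X}), \sum_(y <- B) p x y <= C.
Local Notation K := (scalar_field R s).
Variable P : {linear linf R s X -> linf R s X}.
Hypothesis PE : forall f : linf R s X, P f = transition_op p f :> (X -> K).

(** The constants give [eps / 2] for each of the two parts of the estimate
[transition_op_le] applied to [f - g]: the functions [f] and [g] differ by at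
most [d] on [A] and by at most [q] everywhere. The denominators are increased by
one because [C] and [r] may vanish. *)
Lemma tight_cvg_image (F : set_system (linf R s X)) (FF : ProperFilter F)
    (f : linf R s X) (r : R) : uniformly_tight p ->
  F (linf_ball r) -> linf_ball r f ->
  (forall y, ((g : linf R s X) y : K^o) @[g --> F] --> (f y : K^o)) ->
  P g @[g --> F] --> P f.
Proof.
move=> tight Fr fr gf; apply/cvg_linfP => eps eps0.
pose q := `|r| + `|r|.
have q0 : 0 <= q by rewrite addr_ge0.
have q1 : 0 < q + 1 by rewrite ltr_wpDl.
have C1 : 0 < `|C| + 1 by rewrite ltr_wpDl.
have eps20 : 0 < eps / 2 by rewrite divr_gt0.
pose d := eps / 2 / (`|C| + 1); have d0 : 0 < d by rewrite divr_gt0.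
have [A At] := tight (eps / 2 / (q + 1)) (divr_gt0 eps20 q1).
have near_d : F [set g : linf R s X | forall y : A, absR (f (val y) - g (val y)) <= d].
  by apply: filter_forall => y; have /cvg_absRP := gf (val y); exact.
apply: filterS (filterI Fr near_d) => g [/= gr gd] x.
have -> : (P f - P g) x = transition_op p (f - g) x by rewrite -PE linearB.
apply: le_trans (transition_op_le p_ge0 p_sum _ A d q (eps / 2 / (q + 1)) x
  (ltW d0) q0 _ _ (At x)) _.
- by move=> y yA; exact: (gd [` yA]%fset).
- move=> y; apply: le_trans (linf_ballB _ _ _ _ fr gr y) _.
  by rewrite lerD// ler_norm.
rewrite [leRHS]splitr; apply: lerD.
  apply: (@le_trans _ _ ((`|C| + 1) * d)); last by rewrite mulrC divfK ?gt_eqF.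
  by rewrite ler_wpM2r ?ltW// ltr_pwDr// ler_norm.
apply: (@le_trans _ _ (eps / 2 / (q + 1) * (q + 1))); last by rewrite divfK ?gt_eqF.
by rewrite ler_wpM2l ?divr_ge0 ?ltW// ltrDl.
Qed.

(** An ultrafilter on the image of the ball is transported to the ball by a
section of [P]. There it converges pointwise to some [f], which stays in the
ball, and [P f] is then a limit of the original ultrafilter. *)
Lemma tight_compact_image (r : R) : uniformly_tight p -> compact (P @` linf_ball r).
Proof.
move=> tight; rewrite compact_ultra => F FU FPr.
have FF : ProperFilter F by exact: ultra_proper.
have secP (h : linf R s X) : exists g, (P @` linf_ball r) h -> linf_ball r g /\ P g = h.
  have [[g gr gh]|nh] := pselect ((P @` linf_ball r) h); first by exists g.
  by exists 0.
have [sec sech] := choice secP.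
have near_sec : \forall h \near F, linf_ball r (sec h) /\ P (sec h) = h.
  by apply: filterS FPr => h /sech.
have near_r : \forall h \near F, linf_ball r (sec h) by apply: filterS near_sec => h [].
have limF y : exists l : K^o, (sec h y : K^o) @[h --> F] --> l.
  by apply: (@ultra_bounded_cvg _ _ _ _ _ _ r); apply: filterS near_r => h; exact.
have [l secl] := choice limF.
have lr y : absR (l y) <= r.
  by apply: absR_le_cvg (secl y) _; apply: filterS near_r => h; exact.
have [f fE] := linf_of_bounded l r lr.
exists (P f); split; first by exists f => // y; rewrite fE.
have Pcvg : P (sec h) @[h --> F] --> P f.
  apply: (@tight_cvg_image (sec @ F) _ f r) => //.
    by move=> y; rewrite fE.
  by move=> y; rewrite fE; exact: secl.
apply: cvg_trans Pcvg => D FD.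
by apply: filterS (filterI near_sec FD) => h [[_ secK]]; rewrite /= secK.
Qed.

Lemma tight_compact_operator : uniformly_tight p -> compact_operator P.
Proof.
move=> tight D /bounded_setP[r Dr].
apply: (@precompact_subset _ _ (P @` linf_ball r)); first exact: image_subset.
apply: compact_precompact; last exact: tight_compact_image.
exact: norm_hausdorff.
Qed.

Lemma indicC_exists (A : {fset X}) : exists f : linf R s X,
  forall y, f y = of_real s (y \notin A)%:R :> K.
Proof.
have le1 y : absR (of_real s (y \notin A)%:R : K) <= 1 :> R
  by rewrite absR_of_real ger0_norm// lern1 leq_b1.
by have [f fE] := linf_of_bounded _ _ le1; exists f.
Qed.

(** The functions [P (ind A)] tend to 0 pointwise as [A] grows; compactness
makes 0 a cluster point in norm, which yields one [A] that is good for all rows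
simultaneously. *)
Lemma compact_operator_tight : compact_operator P -> uniformly_tight p.
Proof.
move=> cptP eps eps0; have FT := @summability.totally_filter X.
have [ind indE] := choice indicC_exists.
have ind1 A : linf_ball 1 (ind A).
  by move=> y; rewrite indE absR_of_real ger0_norm// lern1 leq_b1.
have /cptP : bounded_set (@linf_ball R s X 1) by apply/bounded_setP; exists 1.
rewrite precompactE => cptcl.
have ind_im A : closure (P @` linf_ball 1) (P (ind A)).
  by apply: subset_closure; exists (ind A).
have near_im : (P (ind A) @[A --> summability.totally]) (closure (P @` linf_ball 1)).
  by apply: (filterS _ (@filterT _ _ FT)) => A _; exact: ind_im.
have [g [_ clg]] := cptcl (P (ind A) @[A --> summability.totally]) _ near_im.
have tail0 x d : 0 < d -> \forall A \near summability.totally, absR (P (ind A) x) <= d.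
  move=> d0; have [A0 A0d] := bounded_sums_tail _ _ (p_ge0 x) (p_sum x) _ d0.
  apply: (@near_totally _ _ A0) => A A0A.
  rewrite PE; apply: le_trans (transition_op_le p_ge0 p_sum _ A 0 1 d x
    _ _ _ (ind1 A) _) _ => //.
  - by move=> y yA; rewrite indE yA absR_of_real normr0.
  - by move=> B BA; apply: A0d; apply: fdisjointWr BA.
  - by rewrite mulr0 add0r mulr1.
have near_g d : 0 < d -> \forall h \near g, linf_ball d (g - h).
  by have /cvg_linfP := @cvg_id _ (nbhs g) : (fun h => h) @ nbhs g --> g; exact.
(* A norm cluster point is a pointwise cluster point, hence 0. *)
have g0 : g = 0.
  apply: val_inj; apply/funext => x; apply: absR_eq0; apply/eqP.
  rewrite eq_le absR_ge0 andbT; apply/ler_addgt0Pr => d d0; rewrite add0r.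
  have d20 : 0 < d / 2 by rewrite divr_gt0.
  have [h [/= hd gh]] := clg [set h : linf R s X | absR (h x) <= d / 2] _
    (tail0 x _ d20) (near_g _ d20).
  rewrite [d]splitr -[val g x](subrK (h x)); apply: le_trans (absRD _ _) _.
  by apply: lerD hd; exact: (gh x).
have near_range : (P (ind A) @[A --> summability.totally]) (range (fun A => P (ind A))).
  by apply: (filterS _ (@filterT _ _ FT)) => A _; exists A.
have [_ [[A _ <-] PAeps]] := clg _ _ near_range (near_g _ eps0).
exists A => x B BA.
have : absR (P (ind A) x) <= eps.
  by have := PAeps x; rewrite g0 sub0r -[absR _]absRN opprK.
apply: le_trans; rewrite PE.
pose a y := p x y * (y \notin A)%:R.
have a0 y : 0 <= a y by rewrite mulr_ge0.
have aC (D : {fset X}) : \sum_(y <- D) a y <= C.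
  apply: le_trans (p_sum x D); apply: ler_sum => y _.
  by rewrite ler_piMr// lern1 leq_b1.
have -> : transition_op p (ind A) x = summability.sum (fun y => of_real s (a y) : K^o).
  by congr summability.sum; apply/funext => y; rewrite indE -of_realM.
apply: (le_trans _ (ler_sum_absR _ _ B a0 aC)).
rewrite big_seq [leRHS]big_seq; apply: ler_sum => y yB.
by rewrite /a (fdisjointP BA _ yB) mulr1.
Qed.

End Compactness.

(** * Tightness and enumerations *)

Section UniformTails.
Context {R : realType} {X : choiceType} {p : X -> X -> R} {e : nat -> X}.
Hypothesis p_ge0 : forall x y, 0 <= p x y.
Hypothesis e_bij : bijective e.

Lemma tail_esum_leP n x (r : R) :
  (\esum_(i in [set i | (n < i)%N]) (p x (e i))%:E <= r%:E)%E <->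
  (forall B : {fset X}, [set` B] `<=` e @` [set i | (n < i)%N] ->
     \sum_(y <- B) p x y <= r).
Proof.
rewrite -esum_le_sumP// esum_image//.
by move=> i j _ _; exact: (bij_inj e_bij).
Qed.

Lemma uniform_tails_tight : uniform_tails p e -> uniformly_tight p.
Proof.
move=> tails eps eps0.
have [n _ /(_ n (leqnn n)) tail_n] := tails _ (nbhs_open_ereal_lt (f := fun=> eps) eps0).
exists [fset e i | i in iota 0 n.+1]%fset => x B BA.
apply: (tail_esum_leP n x eps).1 => [|y /= yB].
  apply: le_trans (ltW tail_n); apply: ereal_sup_ubound.
  by exists x.
have [e' e'K eK] := e_bij; exists (e' y) => //=.
rewrite ltnNge; apply/negP => e'n.
have /negP := fdisjointP BA _ yB; apply; apply/imfsetP; exists (e' y); last by rewrite eK.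
by change (e' y \in iota 0 n.+1); rewrite mem_iota.
Qed.

Lemma tight_uniform_tails : uniformly_tight p -> uniform_tails p e.
Proof.
move=> tight; have [e' e'K eK] := e_bij.
have tails_ge0 n : (0 <= ereal_sup
     [set (\esum_(i in [set i | (n < i)%N]) (p x (e i))%:E) | x in [set: X]])%E.
  apply: le_trans (ereal_sup_ubound _); last by exists (e 0%N).
  by apply: esum_ge0 => i _; rewrite lee_fin.
have near_tails eps : 0 < eps -> \forall n \near \oo, (ereal_sup
     [set (\esum_(i in [set i | (n < i)%N]) (p x (e i))%:E) | x in [set: X]] <= eps%:E)%E.
  move=> eps0; have [A Aeps] := tight eps eps0.
  (* Past the largest index of an element of [A], the tail avoids [A]. *)
  exists (\max_(y <- A) e' y) => // n /= An; apply: ge_ereal_sup => _ [x _ <-].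
  apply/tail_esum_leP => B Bn; apply: Aeps; apply/fdisjointP => y yB; apply/negP => yA.
  have [i /= ni iy] := Bn y yB; move: ni; rewrite ltnNge => /negP; apply.
  apply: leq_trans An; rewrite -(e'K i) iy.
  exact: (@leq_bigmax_seq _ (enum_fset A) xpredT e' y).
rewrite /uniform_tails; apply/fine_cvgP; split.
  apply: filterS (near_tails 1 ltr01) => n n1; rewrite ge0_fin_numE//.
  by apply: le_lt_trans n1 _; exact: ltry.
apply/cvgrPdist_le => eps eps0; apply: filterS (near_tails eps eps0) => n neps /=.
rewrite sub0r normrN ger0_norm ?fine_ge0//.
by rewrite -lee_fin fineK// ge0_fin_numE//; apply: le_lt_trans neps _; exact: ltry.
Qed.

Lemma uniform_tailsP : uniform_tails p e <-> uniformly_tight p.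
Proof. by split; [exact: uniform_tails_tight|exact: tight_uniform_tails]. Qed.

End UniformTails.

(** * Compactness criterion *)

Theorem theorem2p2 (R : realType) (s : scalars) (X : choiceType)
    (e : nat -> X) (e_bij : bijective e)
    (p : X -> X -> R) (p_ge0 : forall x y : X, 0 <= p x y)
    (p_sup : (ereal_sup
       [set \esum_(y in [set: X]) (p x y)%:E | x in [set: X]] < +oo)%E) :
  (exists P : {linear linf R s X -> linf R s X},
     [/\ forall f : linf R s X,
           transition_dom p f /\ P f = transition_op p f :> (X -> scalar_field R s),
         bounded_operator P
       & compact_operator P <-> uniform_tails p e]) /\
  (forall e' : nat -> X, bijective e' ->
     uniform_tails p e <-> uniform_tails p e').
Proof.
split; last first.
  by move=> e' e'_bij; rewrite (uniform_tailsP p_ge0 e_bij) (uniform_tailsP p_ge0 e'_bij).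
have [C p_sum] := row_sums_bounded p_ge0 p_sup.
have [P PE] := transition_linear_exists (s := s) p_ge0 p_sum.
have C0 : 0 <= C by have := p_sum (e 0%N) fset0; rewrite big_seq_fset0.
exists P; split.
- move=> f; split=> //; have /linf_predP[r fr] := valP f.
  by apply: (transition_dom_bounded p_ge0 p_sum _ r) => y; apply: fr; exists y.
- exists (of_real s C) => f.
  have normE (g : linf R s X) : `|g| = linf_norm g by [].
  rewrite (normE f) /linf_norm -of_realM.
  apply/linf_norm_leP => [|x]; first by rewrite mulr_ge0 ?linf_sup_ge0.
  rewrite PE; apply: (transition_op_bounded p_ge0 p_sum) => y.
  exact: absR_le_linf.
- rewrite (uniform_tailsP p_ge0 e_bij); split.
    exact: (compact_operator_tight p_ge0 p_sum P PE).
  exact: (tight_compact_operator p_ge0 p_sum P PE).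
Qed.
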